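(* Let $X$ be a Polish space, let $\Omega:=X^{\mathbb{N}}$ with the Borel $\sigma$-algebra of the product topology, and let $\mathbb{P}=\bigotimes_{n\in\mathbb{N}}\mu$ for some Borel probability measure $\mu$ on $X$. Let $V:\Omega\to\mathbb{R}$ be measurable and non-negative with $0<\int_\Omega V\,d\mathbb{P}<\infty$. Then the Borel probability measure $\mathbb{P}'$ on $\Omega$ defined by $$\frac{d\mathbb{P}'}{d\mathbb{P}}(\omega):=\frac{V(\omega)}{\int_\Omega V\,d\mathbb{P}}$$ is an algorithmic reassortment of $\mathbb{P}$.
   Context: $\Pi_\infty$ denotes the group of all bijections $\sigma:\mathbb{N}\to\mathbb{N}$ that fix all but finitely many elements of $\mathbb{N}$, with the topology of pointwise convergence and its Borel $\sigma$-algebra $\mathcal{B}(\Pi_\infty)$. It acts on $\Omega$ by $\sigma\cdot\{\omega_n\}_{n\in\mathbb{N}}:=\{\omega_{\sigma^{-1}(n)}\}_{n\in\mathbb{N}}$. For $\omega\in\Omega$ let $a_\omega:\Pi_\infty\to\Omega$ be $a_\omega(\sigma):=\sigma\cdot\omega$. For Borel probability measures $\mathbb{P},\mathbb{P}'$ on $\Omega$, $\mathbb{P}'$ is an algorithmic reassortment of $\mathbb{P}$ if there exists a transition kernel (probability kernel) $K:\Omega\times\mathcal{B}(\Pi_\infty)\to[0,1]$ such that $\mathbb{P}'(A)=\int_\Omega K(\omega,a_\omega^{-1}(A))\,d\mathbb{P}(\omega)$ for all Borel $A\subseteq\Omega$. *)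

(* Defs.v *)
From HB Require Import structures.
From mathcomp Require Import all_boot all_order all_algebra.
From mathcomp Require Import all_classical all_reals all_analysis.
From mathcomp Require Import measurable_realfun.

Set Implicit Arguments.
Unset Strict Implicit.
Unset Printing Implicit Defensive.
Import Order.TTheory GRing.Theory Num.Theory.
Import numFieldNormedType.Exports.
Local Open Scope classical_set_scope.
Local Open Scope ring_scope.

Notation borel T := (g_sigma_algebraType (@open T)).

Definition separable (T : topologicalType) : Prop :=
  exists2 D : set T, countable D & dense D.

Definition is_distance (R : realType) (T : Type) (d : T -> T -> R) : Prop :=
  [/\ forall x y, 0 <= d x y,
      forall x y, d x y = 0 <-> x = y,
      forall x y, d x y = d y x &
      forall x y z, d x z <= d x y + d y z].

Definition distance_compatible (R : realType) (T : topologicalType)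
    (d : T -> T -> R) : Prop :=
  forall (x : T) (A : set T),
    nbhs x A <-> exists2 e : R, 0 < e & [set y | d x y < e] `<=` A.

Definition distance_complete (R : realType) (T : topologicalType)
    (d : T -> T -> R) : Prop :=
  forall u : nat -> T,
    (forall e : R, 0 < e -> exists N : nat,
      forall m n : nat, (N <= m)%N -> (N <= n)%N -> d (u m) (u n) < e) ->
    exists l : T, u @ \oo --> l.

Definition completely_metrizable (R : realType) (T : topologicalType) : Prop :=
  exists d : T -> T -> R,
    [/\ is_distance d, distance_compatible d & distance_complete d].

Definition polish (R : realType) (T : topologicalType) : Prop :=
  separable T /\ completely_metrizable R T.

(* X^N with the product topology; X is pointed because the library's
   measurable types are, which excludes only the empty space (on which there
   is no probability measure). *)
Notation seq_space X := {ptws nat -> X}.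

(* P is the product of countably many copies of mu: it is given on the finite
   dimensional cylinders by the product rule, which determines it. *)
Definition is_product_measure (R : realType) (X : ptopologicalType)
    (mu : probability (borel X) R)
    (P : probability (borel (seq_space X)) R) : Prop :=
  forall (n : nat) (A : nat -> set (borel X)),
    (forall i, measurable (A i)) ->
    P [set w | forall i, (i < n)%N -> A i (w i)]
      = (\prod_(i < n) mu (A i))%E.

Definition finitary_perms : set {ptws nat -> nat} :=
  [set s : nat -> nat | bijective s /\ finite_set [set n | s n <> n]].

(* The subtype carries the topology induced by that of pointwise convergence,
   nat being discrete. *)
Definition finperm := set_type finitary_perms.

HB.instance Definition _ := Topological.on finperm.

Lemma id_finitary : finitary_perms id.
Proof.
split; first by exists id.
rewrite (_ : [set n | _] = set0); first exact: finite_set0.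
by apply/seteqP; split => n //=.
Qed.

HB.instance Definition _ := isPointed.Build finperm (SigSub (mem_set id_finitary)).

Definition finperm_fun (s : finperm) : nat -> nat := set_val s.

Definition finperm_inv (s : finperm) : nat -> nat :=
  pinv [set: nat] (finperm_fun s).

Lemma finperm_funK (s : finperm) : cancel (finperm_fun s) (finperm_inv s).
Proof.
have [+ _] := set_mem (valP s) => /bij_inj inj_s n.
by apply: pinvKV; rewrite ?inE// => x y _ _; exact: inj_s.
Qed.

Lemma finperm_invK (s : finperm) : cancel (finperm_inv s) (finperm_fun s).
Proof.
have [+ _] := set_mem (valP s) => -[g _ gK] n.
by apply: pinvK; rewrite inE; exists (g n) => //; exact: gK.
Qed.

Definition act (X : Type) (s : finperm) (w : seq_space X) : seq_space X :=
  fun n => w (finperm_inv s n).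

Definition algorithmic_reassortment (R : realType) (X : ptopologicalType)
    (P P' : probability (borel (seq_space X)) R) : Prop :=
  exists K : R.-pker (borel (seq_space X)) ~> (borel finperm),
    forall A : set (borel (seq_space X)), measurable A ->
      (P' A = \int[P]_w K w ((fun s : finperm => act s w) @^-1` A))%E.

Section reweighting.
Context (d : measure_display) (T : measurableType d) (R : realType).
Context (P : probability T R) (V : T -> R).
Hypothesis mV : measurable_fun [set: T] V.
Hypothesis V0 : forall w, 0 <= V w.
Hypothesis intV_gt0 : (0 < \int[P]_w (V w)%:E)%E.
Hypothesis intV_fin : (\int[P]_w (V w)%:E < +oo)%E.

(* The measure with density V / \int V with respect to P; the unused proofs
   are arguments so that it is canonically a probability measure. *)
Definition reweight of measurable_fun [set: T] V & (forall w, 0 <= V w)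
    & (0 < \int[P]_w (V w)%:E)%E & (\int[P]_w (V w)%:E < +oo)%E :=
  fun A : set T => (\int[P]_(w in A) (V w / \int[P]_w V w)%R%:E)%E : \bar R.

Let nu := reweight mV V0 intV_gt0 intV_fin.

Let intV_ge0 : 0 <= \int[P]_w V w.
Proof. by apply: fine_ge0; exact: ltW. Qed.

Let density_ge0 w : (0 <= (V w / \int[P]_w V w)%R%:E)%E.
Proof. by rewrite lee_fin divr_ge0. Qed.

Let mdensity : measurable_fun [set: T]
  (fun w => (V w / \int[P]_w V w)%R%:E : \bar R).
Proof. by apply/measurable_EFinP; exact: measurable_funM. Qed.

Let nu0 : nu set0 = 0%E.
Proof. by rewrite /nu /reweight integral_set0. Qed.

Let nu_ge0 A : (0 <= nu A)%E.
Proof. by apply: integral_ge0 => w _; exact: density_ge0. Qed.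

Let nu_sigma_additive : semi_sigma_additive nu.
Proof.
move=> F mF tF mUF; rewrite /nu /reweight ge0_integral_bigcup//.
- by apply: is_cvg_nneseries => n _ _; exact: nu_ge0.
- exact: measurable_funTS.
Qed.

HB.instance Definition _ := isMeasure.Build _ _ _
  (reweight mV V0 intV_gt0 intV_fin) nu0 nu_ge0 nu_sigma_additive.

Let nu_setT : nu [set: T] = 1%E.
Proof.
have intV_neq0 : \int[P]_w V w != 0.
  by rewrite gt_eqF// fine_gt0// intV_gt0 intV_fin.
rewrite /nu /reweight (_ : (fun w => _) =
    (fun w => (\int[P]_w V w)^-1%:E * (V w)%:E)%E); last first.
  by apply/funext => w; rewrite -EFinM mulrC.
rewrite ge0_integralZl//; last 3 first.
- exact/measurable_EFinP.
- by move=> w _; rewrite lee_fin.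
- by rewrite lee_fin invr_ge0.
rewrite (_ : (\int[P]_w (V w)%:E)%E = (\int[P]_w V w)%:E); last first.
  by rewrite /Rintegral fineK// ge0_fin_numE// ltW.
by rewrite -EFinM mulVf.
Qed.

HB.instance Definition _ := Measure_isProbability.Build _ _ _
  (reweight mV V0 intV_gt0 intV_fin) nu_setT.

End reweighting.

(* Main.v *)
Require Import Defs.
From HB Require Import structures.
From mathcomp Require Import all_boot all_order all_algebra.
From mathcomp Require Import all_classical all_reals all_analysis.
From mathcomp Require Import measurable_realfun.
From mathcomp Require Import ring.

Set Implicit Arguments.
Unset Strict Implicit.
Unset Printing Implicit Defensive.
Import Order.TTheory GRing.Theory Num.Theory.
Import numFieldNormedType.Exports.
Local Open Scope classical_set_scope.
Local Open Scope ring_scope.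

(* A greedy transport of P onto P'.  Let g_n exchange the coordinates in
   [0, n) with those in [n, 2n).  Start with supply 1 and demand dP'/dP; at
   stage n, move from w to g_n w the minimum of the supply left at w and of the
   demand left at g_n w.  Afterwards no g_n sends a point with leftover supply
   to a point with leftover demand.  Since P(g_n^-1 A \cap B) tends to
   P(A) P(B), exactly reached on cylinders and extended to all Borel sets by
   the pi-lambda theorem, one of the two leftovers vanishes almost everywhere;
   both have the same integral because g_n preserves P, so both vanish.  The
   kernel gives g_n the amount moved from w to g_n w as its weight, and the
   identity the leftover supply, so that its total mass is 1 at every w. *)

(** * Greedy transport along measure-preserving involutions *)

Lemma telescoping_nneseries (R : realType) (u c : nat -> R) (l : R) :
    (forall n, 0 <= c n) -> (forall n, u n.+1 = u n - c n) ->
    u @ \oo --> l ->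
  ((u 0%N)%:E = \sum_(n <oo) (c n)%:E + l%:E)%E.
Proof.
move=> c0 uS ul.
suff -> : (\sum_(n <oo) (c n)%:E = (u 0%N - l)%:E)%E.
  by rewrite -EFinD subrK.
apply/cvg_lim => //.
rewrite (_ : (fun n : nat => _) = (fun n => (u 0%N - u n)%:E)); last first.
  apply/funext => n; rewrite sumEFin; congr (_%:E).
  rewrite (@telescope_sumr_eq _ 0 n (fun k => - u k)) ?opprK 1?addrC//.
  by move=> k _; rewrite uS opprK opprB subrK.
by apply: cvg_EFin; [exact: nearW|apply: cvgB => //; exact: cvg_cst].
Qed.

Section greedy_transport.
Context (d : measure_display) (T : measurableType d) (R : realType).
Variables (P : probability T R) (g : nat -> T -> T) (h0 : T -> R).
Hypothesis mg : forall n, measurable_fun [set: T] (g n).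
Hypothesis gK : forall n, involutive (g n).
Hypothesis Pg : forall n A, measurable A -> P (g n @^-1` A) = P A.
(** The form in which mixing enters the transport; [mixing_sweep] derives it from asymptotic
    independence on a generating pi-system. *)
Hypothesis g_sweep : forall A B, measurable A -> measurable B ->
  P A != 0%E -> P B != 0%E -> exists n, (g n @^-1` A) `&` B !=set0.
Hypothesis mh0 : measurable_fun [set: T] h0.
Hypothesis h0_ge0 : forall w, 0 <= h0 w.
Hypothesis inth0 : (\int[P]_w (h0 w)%:E = 1)%E.

(* The remaining supply and the unmet demand: at stage [n] as much mass as
   possible is moved from [w] to [g n w]. *)
Fixpoint greedy (n : nat) : (T -> R) * (T -> R) :=
  if n is k.+1 then
    let: (f, h) := greedy k in
    (fun w => f w - Num.min (f w) (h (g k w)),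
     fun w => h w - Num.min (f (g k w)) (h w))
  else (cst 1, h0).

Let supply n : T -> R := (greedy n).1.
Let demand n : T -> R := (greedy n).2.
(** The same moved mass, indexed by its source in [shipped] and by its target in [received]: as
    [g n] is an involution, what arrives at [w] comes from [g n w]. *)
Let shipped n w := Num.min (supply n w) (demand n (g n w)).
Let received n w := Num.min (supply n (g n w)) (demand n w).

Let supplyS n w : supply n.+1 w = supply n w - shipped n w.
Proof. by rewrite /shipped /supply /demand /=; case: (greedy n). Qed.

Let demandS n w : demand n.+1 w = demand n w - received n w.
Proof. by rewrite /received /supply /demand /=; case: (greedy n). Qed.

Let receivedE n w : received n w = shipped n (g n w).
Proof. by rewrite /received /shipped gK. Qed.

Let greedy_ge0 n : (forall w, 0 <= supply n w) /\ (forall w, 0 <= demand n w).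
Proof.
elim: n => [|n [f0 h_ge0]]; first by split => // w; exact: ler01.
by split => w; rewrite (supplyS, demandS) subr_ge0 ge_min lexx ?orbT.
Qed.

Let supply_ge0 n w : 0 <= supply n w. Proof. exact: (greedy_ge0 n).1. Qed.
Let demand_ge0 n w : 0 <= demand n w. Proof. exact: (greedy_ge0 n).2. Qed.

Let shipped_ge0 n w : 0 <= shipped n w.
Proof. by rewrite le_min supply_ge0 demand_ge0. Qed.

Let received_ge0 n w : 0 <= received n w.
Proof. by rewrite receivedE. Qed.

Let mgreedy n : measurable_fun [set: T] (supply n) /\
  measurable_fun [set: T] (demand n).
Proof.
elim: n => [|n [mf mh]]; first by split => //; exact: measurable_cst.
split.
  rewrite (_ : supply n.+1 = supply n \- shipped n); last first.
    by apply/funext => w; rewrite supplyS.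
  apply: measurable_funB => //; apply: measurable_minr => //.
  exact: measurableT_comp.
rewrite (_ : demand n.+1 = demand n \- received n); last first.
  by apply/funext => w; rewrite demandS.
apply: measurable_funB => //; apply: measurable_minr => //.
exact: measurableT_comp.
Qed.

Let msupply n : measurable_fun [set: T] (supply n).
Proof. exact: (mgreedy n).1. Qed.

Let mdemand n : measurable_fun [set: T] (demand n).
Proof. exact: (mgreedy n).2. Qed.

Let mshipped n : measurable_fun [set: T] (shipped n).
Proof. by apply: measurable_minr => //; exact: measurableT_comp. Qed.

Let mreceived n : measurable_fun [set: T] (received n).
Proof. by apply: measurable_minr => //; exact: measurableT_comp. Qed.

(** The leftovers after all stages; the limits exist because both sequences are nonincreasing and
    bounded below by 0. *)
Let supply_lim w : R := limn (supply ^~ w).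
Let demand_lim w : R := limn (demand ^~ w).

Let supply_ni w : nonincreasing_seq (supply ^~ w).
Proof. by apply/nonincreasing_seqP => n; rewrite supplyS gerBl. Qed.

Let demand_ni w : nonincreasing_seq (demand ^~ w).
Proof. by apply/nonincreasing_seqP => n; rewrite demandS gerBl. Qed.

Let supply_cvg w : supply ^~ w @ \oo --> supply_lim w.
Proof.
by apply: nonincreasing_is_cvgn => //; exists 0 => _ [n _ <-].
Qed.

Let demand_cvg w : demand ^~ w @ \oo --> demand_lim w.
Proof.
by apply: nonincreasing_is_cvgn => //; exists 0 => _ [n _ <-].
Qed.

Let supply_lim_ge0 w : 0 <= supply_lim w.
Proof. by apply: limr_ge; [exact: supply_cvg|exact: nearW]. Qed.

Let demand_lim_ge0 w : 0 <= demand_lim w.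
Proof. by apply: limr_ge; [exact: demand_cvg|exact: nearW]. Qed.

Let msupply_lim : measurable_fun [set: T] supply_lim.
Proof. by apply: (measurable_fun_cvg msupply) => w _; exact: supply_cvg. Qed.

Let mdemand_lim : measurable_fun [set: T] demand_lim.
Proof. by apply: (measurable_fun_cvg mdemand) => w _; exact: demand_cvg. Qed.

Let supply_split w :
  (1 = \sum_(n <oo) (shipped n w)%:E + (supply_lim w)%:E)%E.
Proof. exact: (@telescoping_nneseries _ (supply ^~ w)). Qed.

Let demand_split w :
  ((h0 w)%:E = \sum_(n <oo) (received n w)%:E + (demand_lim w)%:E)%E.
Proof. exact: (@telescoping_nneseries _ (demand ^~ w)). Qed.

Let integral_comp_g n (phi : T -> \bar R) : measurable_fun [set: T] phi ->
  (forall w, 0 <= phi w)%E -> (\int[P]_w phi (g n w) = \int[P]_w phi w)%E.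
Proof.
move=> mphi phi0.
have := @ge0_integral_pushforward _ _ _ _ _ _ (mg n) P setT phi
  measurableT mphi (fun y _ => phi0 y).
rewrite preimage_setT => <-.
apply: eq_measure_integral => A mA _.
exact: Pg.
Qed.

(* The points where supply remains are never sent by any [g n] to points where
   demand remains, so by [g_sweep] one of the two sets is negligible. *)
Let exhausted_disj n w : 0 < supply_lim w -> 0 < demand_lim (g n w) -> False.
Proof.
(* Stage [n] subtracts the same minimum from the supply at [w] and from the demand at [g n w], so at
   index [n.+1] one of them is 0, and the limits lie below these values. *)
have := nonincreasing_cvgn_ge (supply_ni w) (@supply_cvg w) n.+1.
have := nonincreasing_cvgn_ge (demand_ni (g n w))
  (@demand_cvg (g n w)) n.+1.
rewrite supplyS demandS receivedE gK /shipped => hle fle f_gt0 h_gt0.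
have := lt_le_trans f_gt0 fle; have := lt_le_trans h_gt0 hle.
rewrite !subr_gt0 !gt_min !ltxx orbF /= => fh hf.
by have := lt_trans fh hf; rewrite ltxx.
Qed.

Let msupport (f : T -> R) : measurable_fun [set: T] f ->
  measurable [set w | 0 < f w].
Proof.
move=> mf; rewrite (_ : [set w | _] =
    setT `&` (fun w => 0 < f w) @^-1` [set true]).
  by apply: measurable_fun_ltr => //; exact: measurable_cst.
by rewrite setTI; apply/seteqP; split => w /=; [move=> ->|].
Qed.

Let integral_eq0_of_support (f : T -> R) : measurable_fun [set: T] f ->
  (forall w, 0 <= f w) -> P [set w | 0 < f w] = 0%E ->
  (\int[P]_w (f w)%:E = 0)%E.
Proof.
move=> mf f0 Pf.
rewrite -(integral0 P setT); apply: ge0_ae_eq_integral => //=.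
- exact/measurable_EFinP.
- by move=> x _; rewrite lee_fin.
- exists [set w | 0 < f w]; split => //; first exact: msupport.
  move=> w /= /not_implyP[_ fw]; rewrite lt_neqAle f0 andbT eq_sym.
  by apply/eqP => fw0; apply: fw; rewrite fw0.
Qed.

(** Change of variables by [g n]: the mass moved at stage [n] is counted at its target instead of
    its source. *)
Let shipped_received n (phi : T -> \bar R) : measurable_fun [set: T] phi ->
  (forall w, 0 <= phi w)%E ->
  (\int[P]_w ((shipped n w)%:E * phi (g n w)) =
   \int[P]_w ((received n w)%:E * phi w))%E.
Proof.
move=> mphi phi0.
rewrite -(@integral_comp_g n (fun w => (received n w)%:E * phi w)%E).
- by apply: eq_integral => w _; rewrite receivedE gK.
- by apply: emeasurable_funM => //; exact/measurable_EFinP.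
- by move=> w; rewrite mule_ge0// lee_fin.
Qed.

(** Supply and demand both start with integral 1 and lose the same total [s], since what is shipped
    is received. As [s] is at most 1, it can be cancelled. *)
Let integral_supply_lim :
  (\int[P]_w (supply_lim w)%:E = \int[P]_w (demand_lim w)%:E)%E.
Proof.
pose s := (\sum_(n <oo) \int[P]_w (received n w)%:E)%E.
have supplyE : (1 = s + \int[P]_w (supply_lim w)%:E)%E.
  rewrite -(probability_setT P) -[LHS]mul1e -integral_cst//.
  transitivity (\int[P]_w
      (\sum_(n <oo) (shipped n w)%:E + (supply_lim w)%:E))%E.
    by apply: eq_integral => w _; rewrite -supply_split.
  rewrite ge0_integralD//; last 4 first.
  - by move=> w _; apply: nneseries_ge0 => n _ _; rewrite lee_fin.
  - apply: ge0_emeasurable_sum => [n w _ _|n _].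
      by rewrite lee_fin.
    exact/measurable_EFinP.
  - by move=> w _; rewrite lee_fin.
  - exact/measurable_EFinP.
  congr (_ + _)%E; rewrite integral_nneseries//; last 2 first.
  - by move=> n; exact/measurable_EFinP.
  - by move=> n w _; rewrite lee_fin.
  apply: eq_eseriesr => n _.
  transitivity (\int[P]_w ((shipped n w)%:E * cst 1 (g n w)))%E.
    by apply: eq_integral => w _; rewrite /= mule1.
  rewrite shipped_received//.
  by apply: eq_integral => w _; rewrite /= mule1.
have demandE : (1 = s + \int[P]_w (demand_lim w)%:E)%E.
  rewrite -inth0.
  under eq_integral do rewrite demand_split.
  rewrite ge0_integralD//; last 4 first.
  - by move=> w _; apply: nneseries_ge0 => n _ _; rewrite lee_fin.
  - apply: ge0_emeasurable_sum => [n w _ _|n _].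
      by rewrite lee_fin.
    exact/measurable_EFinP.
  - by move=> w _; rewrite lee_fin.
  - exact/measurable_EFinP.
  congr (_ + _)%E; rewrite integral_nneseries//.
  - by move=> n; exact/measurable_EFinP.
  - by move=> n w _; rewrite lee_fin.
have s_fin : s \is a fin_num.
  rewrite ge0_fin_numE; last first.
    apply: nneseries_ge0 => n _ _; apply: integral_ge0 => w _.
    by rewrite lee_fin.
  rewrite (@le_lt_trans _ _ 1%E) ?ltry// supplyE leeDl//.
  by apply: integral_ge0 => w _; rewrite lee_fin.
rewrite -[LHS](addeK _ s_fin) -[RHS](addeK _ s_fin).
by rewrite ![(_ + s)%E]addeC -supplyE -demandE.
Qed.

(** If one leftover has negligible support, its integral is 0 and equality of the integrals settles
    the other; if neither has, [g_sweep] yields a point excluded by [exhausted_disj]. *)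
Let integral_lims0 : (\int[P]_w (supply_lim w)%:E = 0 /\
  \int[P]_w (demand_lim w)%:E = 0)%E.
Proof.
have [Ps|Ps] := eqVneq (P [set w | 0 < supply_lim w]) 0%E.
  by rewrite -integral_supply_lim; split; exact: integral_eq0_of_support.
have [Pd|Pd] := eqVneq (P [set w | 0 < demand_lim w]) 0%E.
  by rewrite integral_supply_lim; split; exact: integral_eq0_of_support.
have [n [w [/= dw sw]]] :=
  g_sweep (msupport mdemand_lim) (msupport msupply_lim) Pd Ps.
by case: (exhausted_disj sw dw).
Qed.

Theorem greedy_transport : exists c : nat -> T -> R,
  [/\ forall n, measurable_fun [set: T] (c n),
      forall n w, 0 <= c n w,
      forall w, (\sum_(n <oo) (c n w)%:E = 1)%E &
      forall A, measurable A ->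
        (\sum_(n <oo) \int[P]_w ((c n w)%:E *
             (\1_A (if n is k.+1 then g k w else w))%:E) =
         \int[P]_(w in A) (h0 w)%:E)%E].
Proof.
(* Index 0 stands for the identity and carries the leftover supply, so that the weights sum to 1 at
   every point and not only almost everywhere. *)
pose c n := if n is k.+1 then shipped k else supply_lim.
have c0 n w : 0 <= c n w.
  by case: n => [|n]; [exact: supply_lim_ge0|exact: shipped_ge0].
have mc n : measurable_fun [set: T] (c n).
  by case: n => [|n]; [exact: msupply_lim|exact: mshipped].
exists c; split => //.
  move=> w; rewrite nneseries_recl//; last by move=> k _; rewrite lee_fin.
  rewrite addeC (supply_split w); congr (_ + _)%E.
  rewrite -(@nneseries_addn _ (fun n => (c n w)%:E) 1)//.
    by apply: eq_eseriesr => n _; rewrite addn1.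
  by move=> n; rewrite lee_fin.
move=> A mA.
have m1A : measurable_fun [set: T] (fun w => (\1_A w)%:E : \bar R).
  exact/measurable_EFinP/measurable_indic.
have term_ge0 n : (0 <= \int[P]_w ((c n w)%:E *
    (\1_A (if n is k.+1 then g k w else w))%:E))%E.
  by apply: integral_ge0 => w _; rewrite mule_ge0// lee_fin.
have lim0 (f : T -> R) : measurable_fun [set: T] f -> (forall w, 0 <= f w) ->
    (\int[P]_w (f w)%:E = 0 -> \int[P]_w ((f w)%:E * (\1_A w)%:E) = 0)%E.
  move=> mf f0 intf; apply/eqP; rewrite eq_le integral_ge0 ?andbT; last first.
    by move=> w _; rewrite mule_ge0// lee_fin.
  rewrite -[leRHS]intf; apply: ge0_le_integral => //.
  - by move=> w _; rewrite mule_ge0// lee_fin.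
  - by apply: emeasurable_funM => //; exact/measurable_EFinP.
  - exact/measurable_EFinP.
  - by move=> w _; rewrite -EFinM lee_fin ler_piMr// indicE lern1 leq_b1.
have [ints intd] := integral_lims0.
rewrite nneseries_recl// lim0// add0e.
rewrite -(@nneseries_addn _ (fun n => \int[P]_w ((c n w)%:E *
    (\1_A (if n is k.+1 then g k w else w))%:E))%E 1)//.
rewrite [RHS]integral_mkcond epatch_indic.
(* The leftover demand, whose integral is 0, is added back so that [demand_split] recovers [h0] in
   the integrand. *)
transitivity (\int[P]_w (\sum_(n <oo) ((received n w)%:E * (\1_A w)%:E) +
    (demand_lim w)%:E * (\1_A w)%:E))%E; last first.
  apply: eq_integral => w _.
  rewrite /= demand_split ge0_muleDl ?lee_fin//; last first.
    by apply: nneseries_ge0 => n _ _; rewrite lee_fin.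
  congr (_ + _)%E; rewrite muleC -nneseriesZl.
    by apply: eq_eseriesr => n _; rewrite muleC.
  by move=> n _; rewrite lee_fin.
have mr1 n : measurable_fun [set: T]
    (fun w => (received n w)%:E * (\1_A w)%:E)%E.
  by apply: emeasurable_funM => //; exact/measurable_EFinP.
have r1_ge0 n w : (0 <= (received n w)%:E * (\1_A w)%:E)%E.
  by rewrite mule_ge0// lee_fin.
rewrite ge0_integralD//; last 4 first.
- by move=> w _; exact: nneseries_ge0.
- exact: ge0_emeasurable_sum.
- by move=> w _; rewrite mule_ge0// lee_fin.
- by apply: emeasurable_funM => //; exact/measurable_EFinP.
rewrite lim0// adde0 integral_nneseries//.
apply: eq_eseriesr => n _; rewrite addn1/=.
by rewrite (@shipped_received n (fun w => (\1_A w)%:E)).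
Qed.

End greedy_transport.

(** * Mixing: from a generating pi-system to all measurable sets *)

Lemma cvg_uniform_approx (R : realType) (u : nat -> R) (v : nat -> nat -> R)
    (l e : nat -> R) (L : R) :
    (forall k n, `|u n - v k n| <= e k) -> e @ \oo --> (0 : R) ->
    (forall k, v k @ \oo --> l k) -> l @ \oo --> L ->
  u @ \oo --> L.
Proof.
move=> uv e0 vl lL; apply/cvgrPdist_le => eps eps_gt0.
have eps3 : 0 < eps / 3 by rewrite divr_gt0.
have /cvgrPdist_le/(_ _ eps3)[k1 _ ek] := e0.
have /cvgrPdist_le/(_ _ eps3)[k2 _ lk] := lL.
(* Exchange of limits by thirds of [eps]: [k] is fixed first, from the uniform error and the limit
   of [l], and only then is [n] taken large. *)
pose k := maxn k1 k2.
have /cvgrPdist_le/(_ _ eps3) := vl k.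
apply: filterS => n vn.
have {}ek := ek k (leq_maxl _ _); have {}lk := lk k (leq_maxr _ _).
have {}ek : e k <= eps / 3 by apply: le_trans ek; rewrite sub0r normrN ler_norm.
rewrite (_ : L - u n = (L - l k) + (l k - v k n) + (v k n - u n)); last first.
  by ring.
have vu : `|v k n - u n| <= eps / 3 by rewrite distrC (le_trans (uv k n)).
rewrite (_ : eps = eps / 3 + eps / 3 + eps / 3); last by field.
rewrite (le_trans (ler_normD _ _))// lerD//.
by rewrite (le_trans (ler_normD _ _))// lerD.
Qed.

Lemma setIDD (T : Type) (A B C : set T) :
  A `&` (B `\` C) = (A `&` B) `\` (A `&` C).
Proof.
by apply/seteqP; split => x /=; [case=> Ax [Bx Cx]; split=> // -[]
  |case=> -[Ax Bx] ACx; split=> //; split=> // Cx; exact: ACx].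
Qed.

Section mixing.
Context (d : measure_display) (T : measurableType d) (R : realType).
Variables (P : probability T R) (g : nat -> T -> T).
Hypothesis mg : forall n, measurable_fun [set: T] (g n).
Hypothesis gK : forall n, involutive (g n).
Hypothesis Pg : forall n A, measurable A -> P (g n @^-1` A) = P A.

Let p (A : set T) : R := fine (P A).

Let mixes (A B : set T) :=
  p (g n @^-1` A `&` B) @[n --> \oo] --> p A * p B.

Let mg_preimage n A : measurable A -> measurable (g n @^-1` A).
Proof. by move=> mA; rewrite -[X in measurable X]setTI; exact: mg. Qed.

Let pD A B : measurable A -> measurable B -> B `<=` A ->
  p (A `\` B) = p A - p B.
Proof.
move=> mA mB BA; rewrite /p measureD//; last by rewrite ltey_eq fin_num_measure.
by rewrite setIidr// fineB// fin_num_measure.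
Qed.

Let p_le A B : measurable A -> measurable B -> A `<=` B -> p A <= p B.
Proof.
by move=> mA mB AB; rewrite fine_le ?fin_num_measure// le_measure ?inE.
Qed.

(** Pulling the event back once more by [g n], which preserves [P] and is its own inverse, exchanges
    the two sets. *)
Let mixes_sym A B : measurable A -> measurable B -> mixes A B -> mixes B A.
Proof.
move=> mA mB; rewrite /mixes [p B * _]mulrC.
rewrite (_ : (fun n => p (g n @^-1` B `&` A)) =
             (fun n => p (g n @^-1` A `&` B)))//.
apply/funext => n; rewrite /p -(@Pg n (g n @^-1` A `&` B)); last first.
  by apply: measurableI => //; exact: mg_preimage.
congr (fine (P _)); rewrite setIC preimage_setI; congr (_ `&` _).
by apply/seteqP; split => w; rewrite /= gK.
Qed.

Let mixes_lambda_system A : measurable A ->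
  lambda_system setT [set B | measurable B /\ mixes A B].
Proof.
move=> mA; split=> //=.
- split; first exact: measurableT.
  rewrite /mixes {3}/p probability_setT mulr1.
  under eq_fun do rewrite setIT /p Pg//.
  exact: cvg_cst.
- move=> B C CB [mB AB] [mC AC]; split; first exact: measurableD.
  rewrite /mixes (pD mB mC CB) mulrBr.
  rewrite (_ : (fun n => _) = (fun n =>
    p (g n @^-1` A `&` B) - p (g n @^-1` A `&` C))); first exact: cvgB.
  apply/funext => n; rewrite setIDD pD//.
  + by apply: measurableI => //; exact: mg_preimage.
  + by apply: measurableI => //; exact: mg_preimage.
  + exact: setIS.
- move=> F ndF mF.
  have mFn n : measurable (F n) := (mF n).1.
  have mU : measurable (\bigcup_n F n) by exact: bigcupT_measurable.
  split => //.
  have pF : p (F n) @[n --> \oo] --> p (\bigcup_n F n).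
    apply: fine_cvg; rewrite fineK ?fin_num_measure//.
    exact: nondecreasing_cvg_mu.
  have FU k : F k `<=` \bigcup_n F n by exact: bigcup_sup.
  (* Replacing the union by [F k] costs at most the measure of the union minus [F k], uniformly in
     [n], so the limits in [n] and [k] can be exchanged. *)
  apply: (@cvg_uniform_approx _ _ (fun k n => p (g n @^-1` A `&` F k))
    (fun k => p A * p (F k)) (fun k => p (\bigcup_n F n) - p (F k))).
  + move=> k n.
    have mgA := mg_preimage n mA.
    rewrite -pD//; last 3 first.
    * exact: measurableI.
    * exact: measurableI.
    * exact: setIS.
    rewrite ger0_norm ?fine_ge0// -pD// -setIDD.
    have mUF : measurable (\bigcup_n F n `\` F k) by exact: measurableD.
    by apply: p_le => //; exact: measurableI.
  + by rewrite -(subrr (p (\bigcup_n F n))); apply: cvgB => //; exact: cvg_cst.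
  + by move=> k; exact: (mF k).2.
  + by apply: cvgM => //; exact: cvg_cst.
Qed.

(** Independence on [G] makes the measures of the intersections converge to [P A * P B] for all
    measurable sets; this limit is positive, so some intersection is nonempty. *)
Lemma mixing_sweep (G : set (set T)) :
    measurable = <<s G >> -> setI_closed G ->
    (forall A B, G A -> G B ->
      \forall n \near \oo, P (g n @^-1` A `&` B) = (P A * P B)%E) ->
  forall A B, measurable A -> measurable B ->
    P A != 0%E -> P B != 0%E -> exists n, (g n @^-1` A) `&` B !=set0.
Proof.
move=> mG GI indep A B mA mB PA PB.
have Gm C : G C -> measurable C.
  by move=> GC; rewrite mG; exact: sub_sigma_algebra.
have extend C : measurable C -> (forall D, G D -> mixes C D) ->
    forall D, measurable D -> mixes C D.
  move=> mC CG D mD.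
  suff : <<s G >> `<=` [set D | measurable D /\ mixes C D].
    by rewrite -mG => /(_ D mD)[].
  apply: lambda_system_subset => //; first exact: mixes_lambda_system.
  by move=> E GE; split; [exact: Gm|exact: CG].
have mixG C D : G C -> G D -> mixes C D.
  move=> GC GD; apply: (@cvg_trans _ (nbhs (p C * p D))) => //.
  apply: cvg_near_cst; apply: filterS (indep C D GC GD) => n.
  by rewrite /p => ->; rewrite fineM ?fin_num_measure//; exact: Gm.
(* Both extensions act on the second set: a generator [D] in first place first reaches [A]; after
   the exchange, [A] in first place reaches [B]. *)
have AB : mixes A B.
  apply: (extend A) => // D GD; apply: mixes_sym => //; first exact: Gm.
  apply: (extend D) => //; [exact: Gm|by move=> E GE; exact: mixG].
have p_gt0 C : measurable C -> P C != 0%E -> 0 < p C.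
  move=> mC PC; rewrite fine_gt0// lt0e PC measure_ge0.
  by rewrite ltey_eq fin_num_measure.
have AB_gt0 : 0 < p A * p B by rewrite mulr_gt0// p_gt0.
have /cvgr_gt/(_ _ AB_gt0)[n _ /(_ n (leqnn n))/= nAB] := AB.
exists n; apply/set0P/eqP => AB0.
by move: nAB; rewrite AB0 /p measure0 ltxx.
Qed.

End mixing.

(** * Cylinders and the Borel sets of the sequence space *)

Definition cylinder (X : Type) (n : nat) (A : nat -> set X) : set (nat -> X) :=
  [set w | forall i, (i < n)%N -> A i (w i)].

(** The basis consists of the balls of radius [1/(j+1)] around the points of a countable dense set;
    the index type [nat * nat] records its countability. *)
Lemma polish_metric_basis (R : realType) (X : ptopologicalType) : polish R X ->
  exists (dist : X -> X -> R) (b : nat * nat -> set X),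
    [/\ distance_compatible dist, forall k, open (b k) &
        forall x e, 0 < e ->
          exists2 k, b k x & b k `<=` [set y | dist x y < e]].
Proof.
move=> [[D /countable_injP[f finj] Ddense] [dist [isd comp _]]].
have [d0 dE dC dtri] := isd.
have ball_open x r : open [set y | dist x y < r].
  rewrite openE => y /= xy; apply/comp.
  exists (r - dist x y); rewrite ?subr_gt0//.
  by move=> z /= yz; rewrite (le_lt_trans (dtri x y z))// addrC -ltrBrDr.
(* A left inverse of the enumeration [f] on [D], with [point] as default value off its range. *)
pose u n : X := xget point [set x | D x /\ f x = n].
have uK x : D x -> u (f x) = x.
  move=> Dx; rewrite /u.
  case: xgetP => [y -> [Dy fyx]|/(_ x)/(_ (conj Dx erefl))//].
  by apply: finj; rewrite ?inE.
exists dist, (fun k => [set y | dist (u k.1) y < k.2.+1%:R^-1]); split => //.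
move=> x e e_gt0.
(* Half of [e], since both the distance from [x] to the centre and the radius are below
   [1/(j+1)]. *)
have [j _ /(_ j (leqnn j))/= je] :
    \forall j \near \oo, (j.+1%:R^-1 : R) < e / 2.
  by exact: (near_infty_natSinv_lt (PosNum (divr_gt0 e_gt0 (ltr0n _ 2)))).
have [z [/= xz Dz]] : [set y | dist x y < j.+1%:R^-1] `&` D !=set0.
  apply: Ddense; last exact: ball_open.
  by exists x => /=; rewrite (dE x x).2.
exists (f z, j) => /=; rewrite uK//; first by rewrite dC.
move=> y /= zy; rewrite (le_lt_trans (dtri x z y))// (splitr e) ltrD//.
  exact: lt_trans je.
exact: lt_trans je.
Qed.

(** By contradiction: cylinders constraining the first [n] coordinates to within [1/(n+1)] of those
    of [w] would each contain a point outside [U], and these points converge to [w]. Finite lists of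
    indices describe the cylinders so that there are countably many when [K] is countable. *)
Lemma open_cylinder_cover (R : realType) (X : ptopologicalType) (K : Type)
    (dist : X -> X -> R) (b : K -> set X) (k0 : K) :
    distance_compatible dist ->
    (forall x e, 0 < e -> exists2 k, b k x & b k `<=` [set y | dist x y < e]) ->
  forall (U : set (seq_space X)) w, open U -> U w ->
  exists ks : seq K, let C := cylinder (size ks) (fun i => b (nth k0 ks i)) in
    C w /\ C `<=` U.
Proof.
move=> comp bP U w oU Uw.
have /choice[kk kkP] : forall p : nat * nat, exists k,
    b k (w p.1) /\ b k `<=` [set y | dist (w p.1) y < p.2.+1%:R^-1].
  move=> [i n] /=; have [|k bk bkd] := bP (w i) n.+1%:R^-1; last by exists k.
  by rewrite invr_gt0.
pose ks n := mkseq (fun i => kk (i, n)) n.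
pose C n := cylinder (size (ks n)) (fun i => b (nth k0 (ks n) i)).
have CP n v : C n v <-> forall i, (i < n)%N -> b (kk (i, n)) (v i).
  rewrite /C /cylinder size_mkseq; split => Cv i iN; have := Cv i iN;
    by rewrite nth_mkseq.
have [//|noC] := pselect (exists n, C n `<=` U).
  move=> [n CU]; exists (ks n); split => //.
  by apply/CP => i _; exact: (kkP (i, n)).1.
have /choice[v vP] : forall n, exists v : seq_space X, C n v /\ ~ U v.
  move=> n; apply: contrapT => nov; apply: noC; exists n => v Cv.
  by apply: contrapT => nUv; apply: nov; exists v.
have vw : v @ \oo --> (w : seq_space X).
  apply/cvg_sup => i Q [V] [[W] oW <-] /= Wwi WQ.
  have /comp[e e_gt0 eW] : nbhs (w i) W by exact: open_nbhs_nbhs.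
  have [N _ Ne] : \forall n \near \oo, (n.+1%:R^-1 : R) < e.
    exact: (near_infty_natSinv_lt (PosNum e_gt0)).
  (* Coordinate [i] is constrained by the cylinder of length [n] only once [n] exceeds [i]. *)
  exists (maxn N i.+1) => // n /=; rewrite geq_max => /andP[Nn iln].
  apply: WQ => /=; apply: eW => /=.
  apply: lt_trans (Ne n Nn); apply: (kkP (i, n)).2.
  by have [/CP + _] := vP n; exact.
have [n _ /(_ n (leqnn n))] : \forall n \near \oo, U (v n).
  by apply: vw; exact: open_nbhs_nbhs.
by have [] := vP n.
Qed.

Section sequence_space.
Context (R : realType) (X : ptopologicalType).

Definition cylinders : set (set (borel (seq_space X))) :=
  [set C | exists n A, (forall i, measurable (A i : set (borel X))) /\
                       C = cylinder n A].

(** The reindexing [k] serves twice: the identity gives the cylinders themselves, a block exchange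
    gives its measurability. *)
Lemma measurable_cylinder_comp (k : nat -> nat) n (A : nat -> set (borel X)) :
  (forall i, measurable (A i)) ->
  measurable ((fun w : seq_space X => w \o k) @^-1` cylinder n A
              : set (borel (seq_space X))).
Proof.
move=> mA.
rewrite (_ : _ @^-1` _ =
    \bigcap_(i in `I_n) ((fun w : borel (seq_space X) => w (k i)) @^-1` A i));
  last first.
  by apply/seteqP; split.
apply: fin_bigcap_measurable => // i _.
rewrite -[X in measurable X]setTI.
suff mproj : measurable_fun [set: borel (seq_space X)]
    (fun w => w (k i) : borel X) by exact: mproj.
apply: (@measurability _ _ (borel (seq_space X)) (borel X) setT
  (fun w => w (k i)) (@open X) erefl) => _ [U oU <-].
rewrite setTI; apply: sub_sigma_algebra.
have oUk : open ((fun w : seq_space X => w (k i)) @^-1` U).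
  apply: open_comp => // w _; exact: (@proj_continuous nat (fun=> X) (k i)).
exact: oUk.
Qed.

Lemma measurable_cylinder C : cylinders C -> measurable C.
Proof.
by move=> [n [A [mA ->]]]; exact: (@measurable_cylinder_comp id n A mA).
Qed.

(** Separability enters here: every open set is a countable union of cylinders with basic open
    sides. *)
Lemma borel_seq_spaceE : polish R X ->
  measurable = <<s cylinders >> :> set (set (borel (seq_space X))).
Proof.
move=> /polish_metric_basis[dist [b [comp ob bP]]].
apply/seteqP; split; last first.
  apply: smallest_sub; first exact: sigma_algebra_measurable.
  exact: measurable_cylinder.
apply: smallest_sub; first exact: smallest_sigma_algebra.
move=> U oU.
pose C (ks : seq (nat * nat)) : set (seq_space X) :=
  cylinder (size ks) (fun i => b (nth (0, 0)%N ks i)).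
(* The union runs over all finite lists, a countable type; cylinders not inside [U] are replaced by
   the empty set. *)
have -> : U = \bigcup_ks (if `[< C ks `<=` U >] then C ks else set0).
  apply/seteqP; split => [w Uw|w [ks _]]; last by case: asboolP => // CU /CU.
  have [ks [Cw CU]] :=
    @open_cylinder_cover _ _ _ _ _ (0, 0)%N comp bP U w oU Uw.
  by exists ks => //; rewrite asboolT.
apply: (@countable_bigcupT_measurable _
  (g_sigma_algebraType cylinders)) => // ks.
case: asboolP => _; last exact: measurable0.
apply: sub_sigma_algebra; exists (size ks), (fun i => b (nth (0, 0)%N ks i)).
by split => // i; apply: sub_sigma_algebra; exact: ob.
Qed.

(** Padding with full sides brings cylinders to a common length. *)
Lemma cylinder_widen n m (A : nat -> set X) : (n <= m)%N ->
  cylinder n A = cylinder m (fun i => if (i < n)%N then A i else setT).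
Proof.
move=> nm; apply/seteqP; split => w wA i.
  by case: ifPn => // + _; exact: wA.
by move=> ilt; have := wA i (leq_trans ilt nm); rewrite ilt.
Qed.

Lemma measurable_widen n (A : nat -> set (borel X)) i :
  (forall i, measurable (A i)) -> measurable (if (i < n)%N then A i else setT).
Proof. by case: ifP => // _ mA; exact: measurableT. Qed.

Lemma setI_closed_cylinders : setI_closed cylinders.
Proof.
move=> _ _ [n [A [mA ->]]] [m [B [mB ->]]].
rewrite (cylinder_widen _ (leq_maxl n m)) (cylinder_widen _ (leq_maxr n m)).
exists (maxn n m), (fun i => (if (i < n)%N then A i else setT) `&`
                           (if (i < m)%N then B i else setT)); split.
  by move=> i; apply: measurableI; exact: measurable_widen.
apply/seteqP; split => w.
  by case=> wA wB i im; split; [exact: wA|exact: wB].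
by move=> wAB; split => i im; have [] := wAB i im.
Qed.

End sequence_space.
Arguments cylinders X : clear implicits.

(** * Kernels that are countable mixtures of Dirac masses *)

Lemma dirac_mixture_kernel (d d' : measure_display) (T : measurableType d)
    (Y : measurableType d') (R : realType) (c : nat -> T -> R) (y : nat -> Y) :
    (forall n, measurable_fun [set: T] (c n)) -> (forall n w, 0 <= c n w) ->
    (forall w, (\sum_(n <oo) (c n w)%:E = 1)%E) ->
  exists K : R.-pker T ~> Y,
    forall w U, (K w U = \sum_(n <oo) (c n w)%:E * \d_(y n) U)%E.
Proof.
move=> mc c0 c1.
pose k w : {measure set Y -> \bar R} :=
  mseries (fun n => mscale (NngNum (c0 n w)) (dirac (y n))) 0.
have mk U : measurable U -> measurable_fun [set: T] (k ^~ U).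
  move=> mU; apply: ge0_emeasurable_sum => // n _.
  apply: (@emeasurable_funM _ _ _ _ (fun w => (c n w)%:E)
    (cst (\d_(y n) U : \bar R))); last exact: measurable_cst.
  exact/measurable_EFinP.
have k1 w : k w [set: Y] = 1%E.
  rewrite -(c1 w); apply: eq_eseriesr => n _.
  by rewrite -[LHS]/((c n w)%:E * \d_(y n) [set: Y])%E diracT mule1.
pose kk : R.-ker T ~> Y := HB.pack k (isKernel.Build _ _ _ _ _ k mk).
pose K : R.-pker T ~> Y :=
  HB.pack (Kernel.sort kk) (Kernel_isProbability.Build _ _ _ _ _ kk k1).
by exists K.
Qed.

(** * Exchange of the blocks [0, n) and [n, 2n) as a finitary permutation *)

Definition block_swap (n i : nat) : nat :=
  if (i < n)%N then (i + n)%N else if (i < n + n)%N then (i - n)%N else i.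

Lemma block_swapK n : involutive (block_swap n).
Proof.
move=> i; rewrite /block_swap; have [iltn|ngei] := ltnP i n.
  by by rewrite [X in if X then _ else _]ltnNge leq_addl/= ltn_add2r iltn addnK.
have [ilt2n|n2gei] := ltnP i (n + n).
  by rewrite ltn_subLR// ilt2n subnK.
by rewrite !ltnNge ngei n2gei.
Qed.

Lemma block_swap_lt n m i :
  (n + n <= m)%N -> (i < m)%N -> (block_swap n i < m)%N.
Proof.
move=> nm im; rewrite /block_swap; case: (ltnP i n) => [iltn|_].
  by apply: (leq_trans _ nm); rewrite ltn_add2r.
by case: (ltnP i (n + n)) => // _; rewrite (leq_ltn_trans (leq_subr _ _)).
Qed.

Lemma block_swap_finitary n : finitary_perms (block_swap n).
Proof.
split; first by exists (block_swap n); exact: block_swapK.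
apply: (sub_finite_set _ (finite_II (n + n))) => i /= swapi.
rewrite ltnNge; apply/negP => n2i; apply: swapi.
by rewrite /block_swap !ltnNge n2i (leq_trans (leq_addr n n)).
Qed.

Definition block_perm n : finperm := SigSub (mem_set (block_swap_finitary n)).

(** The action composes with the inverse permutation, which here is the permutation itself. *)
Lemma act_involutive (X : Type) (s : finperm) (w : seq_space X) :
  involutive (finperm_fun s) -> act s w = w \o finperm_fun s.
Proof.
move=> sK; apply/funext => i; rewrite /act /=; congr (w _).
by rewrite -[in LHS](sK i) finperm_funK.
Qed.

Lemma preimage_cylinder (X : Type) (s : nat -> nat) m (A : nat -> set X) :
  involutive s -> (forall i, (i < m)%N -> (s i < m)%N) ->
  (fun w : nat -> X => w \o s) @^-1` cylinder m A = cylinder m (A \o s).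
Proof.
move=> sK sm; apply/seteqP; split => w wA i im /=.
  by have := wA _ (sm i im); rewrite /= sK.
by have := wA _ (sm i im); rewrite /= sK.
Qed.

(** * Invariance and asymptotic independence of the product measure under block exchanges *)

Section product_measure.
Context (R : realType) (X : ptopologicalType).
Variables (mu : probability (borel X) R).
Variables (P : probability (borel (seq_space X)) R).
Hypothesis polishX : polish R X.
Hypothesis P_product : is_product_measure mu P.

Let cylinderE n A : (forall i, measurable (A i : set (borel X))) ->
  P (cylinder n A) = (\prod_(i < n) mu (A i))%E.
Proof. exact: P_product. Qed.

Let g n (w : borel (seq_space X)) : borel (seq_space X) := w \o block_swap n.

Lemma measurable_block_swap n : measurable_fun [set: borel (seq_space X)] (g n).
Proof.
apply: (@measurability _ _ (borel (seq_space X)) (borel (seq_space X)) setT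
  (g n) (cylinders X) (borel_seq_spaceE polishX)) => _ [_ [m [A [mA ->]]] <-].
by rewrite setTI; exact: measurable_cylinder_comp.
Qed.

(** Both measures agree on the pi-system of cylinders: once a cylinder is widened to length at least
    [n + n], the exchange only permutes the factors of the product. *)
Lemma product_measure_block_swap n C : measurable C -> P (g n @^-1` C) = P C.
Proof.
pose gn : {mfun borel (seq_space X) >-> borel (seq_space X)} :=
  HB.pack (g n) (isMeasurableFun.Build _ _ _ _ _ (measurable_block_swap n)).
move=> mC; rewrite -[LHS]/(pushforward P gn C); apply/esym.
apply: (measure_unique (cylinders X) (fun=> setT)) => //.
- exact: (borel_seq_spaceE polishX).
- exact: setI_closed_cylinders.
- move=> _; exists 0%N, (fun=> setT); split => //.
  by apply/seteqP; split.
- by apply/seteqP; split => // w _; exists 0%N.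
- move=> _ [k [A [mA ->]]]; rewrite /pushforward/=.
  pose m := maxn k (n + n).
  rewrite (cylinder_widen _ (leq_maxl k (n + n))) -/m.
  set B := (fun i => if (i < k)%N then A i else setT).
  have mB i : measurable (B i : set (borel X)) by exact: measurable_widen.
  have sm i : (i < m)%N -> (block_swap n i < m)%N.
    by apply: block_swap_lt; exact: leq_maxr.
  rewrite -[RHS]/(P (g n @^-1` _)).
  rewrite (@preimage_cylinder X (block_swap n) m B)//; last exact: block_swapK.
  rewrite !cylinderE//; last by move=> i; exact: mB.
  (* The exchange restricted to the first [m] indices; being injective, it reindexes the product. *)
  pose h (i : 'I_m) := Ordinal (sm i (ltn_ord i)).
  rewrite (reindex_inj (h := h))//.
  move=> i j /(congr1 val) /= ij; apply: val_inj.
  exact: (can_inj (block_swapK n)).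
- move=> _; apply: (@le_lt_trans _ _ 1%E); last exact: ltry.
  exact: probability_le1.
Qed.

(** Once [n] is at least both lengths, [D] constrains coordinates in [0, n) only and the preimage of
    [C] those in [n, 2n) only, so the intersection is a cylinder whose product splits. *)
Lemma product_measure_swap_indep C D : cylinders X C -> cylinders X D ->
  \forall n \near \oo, P (g n @^-1` C `&` D) = (P C * P D)%E.
Proof.
move=> [k [A [mA ->]]] [l [B [mB ->]]]; exists (maxn k l) => // n /=.
rewrite geq_max => /andP[kn ln].
rewrite (cylinder_widen _ kn) (cylinder_widen _ ln).
set A' := (fun i => if (i < k)%N then A i else setT).
set B' := (fun i => if (i < l)%N then B i else setT).
have mA' i : measurable (A' i : set (borel X)) by exact: measurable_widen.
have mB' i : measurable (B' i : set (borel X)) by exact: measurable_widen.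
pose AB i := if (i < n)%N then B' i else A' (i - n)%N.
have mAB i : measurable (AB i : set (borel X)) by rewrite /AB; case: ifP.
rewrite (_ : _ `&` _ = cylinder (n + n) AB); last first.
  apply/seteqP; split => w.
    move=> [wA wB] i ilt; rewrite /AB; case: ltnP => [|ni]; first exact: wB.
    have il : (i - n < n)%N by rewrite ltn_subLR.
    by have := wA _ il; rewrite /g/= /block_swap il subnK.
  move=> wAB; split => i iltn.
    have := wAB (i + n)%N; rewrite ltn_add2r => /(_ iltn).
    by rewrite /AB ltnNge leq_addl/= addnK /g/= /block_swap iltn.
  by have := wAB i (ltn_addr n iltn); rewrite /AB iltn.
(* The first block yields the factor of [D], hence the commutation. *)
rewrite !cylinderE// big_split_ord/= muleC; congr (_ * _)%E.
  by apply: eq_bigr => i _; rewrite /AB/= ltnNge leq_addr/= addKn.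
by apply: eq_bigr => i _; rewrite /AB/= ltn_ord.
Qed.

End product_measure.

(** * Assembly of the kernel *)

Theorem corollary2p10 (R : realType) (X : ptopologicalType)
    (polishX : polish R X)
    (mu : probability (borel X) R)
    (P : probability (borel (seq_space X)) R)
    (P_product : is_product_measure mu P)
    (V : borel (seq_space X) -> R)
    (mV : measurable_fun [set: borel (seq_space X)] V)
    (V_ge0 : forall w, 0 <= V w)
    (intV_gt0 : (0 < \int[P]_w (V w)%:E)%E)
    (intV_fin : (\int[P]_w (V w)%:E < +oo)%E) :
  algorithmic_reassortment P (reweight mV V_ge0 intV_gt0 intV_fin).
Proof.
pose g n (w : borel (seq_space X)) : borel (seq_space X) := w \o block_swap n.
pose h w : R := V w / \int[P]_w V w.
have mh : measurable_fun [set: borel (seq_space X)] h.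
  by apply: measurable_funM => //; exact: measurable_cst.
have h_ge0 w : 0 <= h w.
  by rewrite divr_ge0// fine_ge0// ltW.
(* This integral is the total mass of the reweighted probability. *)
have inth : (\int[P]_w (h w)%:E = 1)%E.
  exact: (probability_setT (reweight mV V_ge0 intV_gt0 intV_fin)).
have mg n : measurable_fun [set: borel (seq_space X)] (g n).
  exact: (measurable_block_swap polishX).
have gK n : involutive (g n).
  by move=> w; apply/funext => i; rewrite /g/= block_swapK.
have Pg n A : measurable A -> P (g n @^-1` A) = P A.
  exact: (product_measure_block_swap polishX P_product).
have sweep := mixing_sweep mg gK Pg (borel_seq_spaceE polishX)
  (@setI_closed_cylinders X) (product_measure_swap_indep P_product).
have [c [mc c_ge0 c1 cE]] := greedy_transport mg gK Pg sweep mh h_ge0 inth.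
(* Same indexing as the weights [c]: the identity at 0, the exchange of blocks of length [k] at
   [k.+1]. *)
pose y n : borel finperm :=
  if n is k.+1 then block_perm k else SigSub (mem_set id_finitary).
have [K KE] := dirac_mixture_kernel y mc c_ge0 c1.
exists K => A mA; transitivity (\int[P]_(w in A) (h w)%:E)%E; first by [].
rewrite -(cE A mA).
rewrite -integral_nneseries//; last 2 first.
- move=> n; apply: emeasurable_funM; first exact/measurable_EFinP.
  by apply/measurable_EFinP; case: n => [|n]; [exact: measurable_indic
    |apply: measurableT_comp => //; exact: measurable_indic].
- by move=> n w _; rewrite mule_ge0 ?lee_fin.
apply: eq_integral => w _; rewrite KE; apply: eq_eseriesr => n _.
rewrite diracE indicE; congr (_ * (_ %:R)%:E)%E.
(* Each move is the action of [y n], so the indicator of [A] at the moved point is the Dirac mass at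
   [y n] of the preimage of [A]. *)
have -> : (if n is k.+1 then g k w else w) = act (y n) w.
  case: n => [|n] /=; first by rewrite act_involutive.
  by rewrite act_involutive//; exact: block_swapK.
by [].
Qed.
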